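(* Let $p,q\in\mathbb{Z}$, let $(G_n)_{n\ge0}$ be defined by $G_0=0$, $G_1=1$ and $G_n=pG_{n-1}+qG_{n-2}$ for $n\ge2$, let $r=p^2+4q\neq0$, and let $s$ be a positive integer. Suppose that one of the following holds: (a) $p$ is odd, $\gcd(p,q)=1$ and $s\mid r$; or (b) $p$ is even, $\gcd(p/2,q)=1$ and $s\mid r/4$; or (c) $\gcd(p,q)=1$ and $s$ is a prime with $s\mid r$. Then: (1) For all integers $n\ge0$: $s\mid n$ if and only if $s\mid G_n$. (2) If for every positive integer $t$, $s\nmid t$ implies $s^2\nmid G_{st}$, then for all integers $k,n\ge0$: $s^k\mid n$ if and only if $s^k\mid G_n$.
   Context: For integers $a,b$, $a\mid b$ means there is an integer $c$ with $b=ca$ (in particular $0\mid 0$); $\gcd$ denotes the greatest common divisor. *)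

(* Defs.v *)
From HB Require Import structures.
From mathcomp Require Import all_boot all_order all_algebra.

Set Implicit Arguments.
Unset Strict Implicit.
Unset Printing Implicit Defensive.

Import GRing.Theory.
Local Open Scope ring_scope.

Fixpoint lucasG (p q : int) (n : nat) : int :=
  match n with
  | 0%N => 0
  | n1.+1 =>
      match n1 with
      | 0%N => 1
      | n2.+1 => p * lucasG p q n1 + q * lucasG p q n2
      end
  end.

Definition lucas_disc (p q : int) : int := p ^+ 2 + 4 * q.

(* When p is even, p and p ^ 2 + 4 * q are multiples of 2 and 4 respectively,
   so the Euclidean quotients below are exact. *)
Definition admissible (p q : int) (s : nat) : Prop :=
  [\/ [/\ ~~ (2 %| p)%Z, gcdz p q = 1 & (s%:Z %| lucas_disc p q)%Z],
      [/\ (2 %| p)%Z, gcdz (p %/ 2)%Z q = 1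
        & (s%:Z %| (lucas_disc p q %/ 4)%Z)%Z]
    | [/\ gcdz p q = 1, prime s & (s%:Z %| lucas_disc p q)%Z]].

(* Main.v *)
(* In every admissible case there is an integer c prime to s with p = 2c and
   q = - c^2 modulo s: modulo s the characteristic polynomial has the double
   root c.  Hence G_(n+1) = (n+1) c^n modulo s, which gives (1).  For (2), let
   alpha be a root of X^2 - pX - q, so that alpha^n = G_n alpha + y with
   y = G_(n+1) - p G_n.  Expanding (G_n alpha + y)^s when s divides n gives
   G_(sn) = s u G_n with u prime to s, and this is iterated. *)
Require Import Defs.
From HB Require Import structures.
From mathcomp Require Import all_boot all_order all_algebra.
From mathcomp Require Import ring zify.

Set Implicit Arguments.
Unset Strict Implicit.
Unset Printing Implicit Defensive.

Import GRing.Theory.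
Local Open Scope ring_scope.

Lemma lucasGSS (p q : int) (n : nat) :
  lucasG p q n.+2 = p * lucasG p q n.+1 + q * lucasG p q n.
Proof. by []. Qed.

(** The first identity compares the coefficients of alpha in alpha^m * alpha^n; the two are proved
    together because each step needs both indices. *)
Lemma lucasG_add (p q : int) (m n : nat) :
  lucasG p q (m + n)
    = lucasG p q m * (lucasG p q n.+1 - p * lucasG p q n)
      + lucasG p q m.+1 * lucasG p q n
  /\ lucasG p q (m + n).+1
    = lucasG p q m.+1 * lucasG p q n.+1 + q * lucasG p q m * lucasG p q n.
Proof.
elim: m => [|m [IH1 IH2]]; first by rewrite add0n /=; split; ring.
by rewrite addSn !lucasGSS IH2 IH1; split; ring.
Qed.

Definition double_root_mod (p q s c : int) : Prop :=
  [/\ (s %| p - 2 * c)%Z, (s %| q + c ^+ 2)%Z & coprimez s c].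

(** As 2 is invertible modulo s, take c = p / 2 there; then 4 (q + c^2) is r modulo s. A common
    divisor of s and p divides 4q = r - p^2, hence q since it is odd, so it is a unit. *)
Lemma double_root_mod_odd (p q : int) (s : nat) :
  odd s -> gcdz p q = 1 -> (s%:Z %| lucas_disc p q)%Z ->
  exists c, double_root_mod p q s c.
Proof.
move=> s_odd pq1 s_r.
have s4 : coprimez s 4 by rewrite /coprimez /gcdz /= (_ : gcdn s 4 = 1%N) //;
  apply/eqP; rewrite -/(coprime s (2 ^ 2)) coprimeXr // coprimen2.
have sp : coprimez s p.
  have gs : (gcdz s p %| s%:Z)%Z by exact: dvdz_gcdl.
  have gp : (gcdz s p %| p)%Z by exact: dvdz_gcdr.
  have g4 : coprimez (gcdz s p) 4 by exact: coprimez_dvdl gs s4.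
  have gq : (gcdz s p %| q)%Z.
    rewrite -(Gauss_dvdzr _ g4).
    have -> : 4 * q = lucas_disc p q - p * p by rewrite /lucas_disc; ring.
    by rewrite rpredB // ?dvdz_mulr // (dvdz_trans gs).
  have : (gcdz s p %| gcdz p q)%Z by rewrite dvdz_gcd gp gq.
  by rewrite pq1 dvdz1 /coprimez.
(* [h] = (s + 1) / 2 is the inverse of 2 modulo s. *)
have [h sE] : exists h : int, s%:Z = 2 * h - 1.
  by exists (s./2.+1)%:Z; have := odd_double_half s; rewrite s_odd; lia.
exists (p * h); split.
- have -> : p - 2 * (p * h) = s%:Z * (- p) by rewrite sE; ring.
  exact: dvdz_mulr.
- rewrite -(Gauss_dvdzr _ s4).
  have -> : 4 * (q + (p * h) ^+ 2)
    = lucas_disc p q + s%:Z * (p ^+ 2 * (2 * h + 1)).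
    by rewrite sE /lucas_disc; ring.
  by rewrite rpredD // dvdz_mulr.
- rewrite coprimezMr sp /=; apply/coprimezP; exists (-1, 2) => /=.
  by rewrite sE; ring.
Qed.

Lemma dvd2_lucas_disc (p q : int) : (2 %| lucas_disc p q)%Z = (2 %| p)%Z.
Proof.
have -> : lucas_disc p q = p * p + 2 * (2 * q) by rewrite /lucas_disc; ring.
have q2 : (2 %| 2 * (2 * q))%Z by exact: dvdz_mulr.
by rewrite (rpredDr _ q2) !dvdzE abszM Euclid_dvdM // orbb.
Qed.

Lemma admissible_double_root (p q : int) (s : nat) :
  admissible p q s -> exists c, double_root_mod p q s c.
Proof.
(* In case (a) an even s would make r, hence p, even. In case (b) c = p/2, as r/4 = c^2 + q. In case
   (c) with s = 2, p is even and q odd, so c = 1. *)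
case=> [[p_odd pq1 s_r]|[/dvdzP[c pE] cq1 s_r]|[pq1 s_prime s_r]].
- apply: double_root_mod_odd => //; apply: contraR p_odd => s_even.
  have s2 : (2 %| s%:Z)%Z by move: s_even; lia.
  by rewrite -(dvd2_lucas_disc p q) (dvdz_trans s2).
- have rE : (lucas_disc p q %/ 4)%Z = c ^+ 2 + q.
    have -> : lucas_disc p q = (c ^+ 2 + q) * 4 by rewrite /lucas_disc pE; ring.
    by rewrite mulzK.
  rewrite rE in s_r; rewrite pE mulzK // in cq1.
  exists c; split.
  + by rewrite pE mulrC subrr dvdz0.
  + by rewrite addrC.
  + have gs : (gcdz s c %| s%:Z)%Z by exact: dvdz_gcdl.
    have gc : (gcdz s c %| c)%Z by exact: dvdz_gcdr.
    have gq : (gcdz s c %| q)%Z.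
      have -> : q = c ^+ 2 + q - c * c by ring.
      by rewrite rpredB // ?dvdz_mulr // (dvdz_trans gs).
    have : (gcdz s c %| gcdz c q)%Z by rewrite dvdz_gcd gc gq.
    by rewrite cq1 dvdz1 /coprimez.
- have [s2|s_odd] := even_prime s_prime; last exact: double_root_mod_odd.
  rewrite s2 in s_r *.
  have p2 : (2 %| p)%Z by rewrite -(dvd2_lucas_disc p q).
  have q2 : ~~ (2 %| q)%Z.
    have : ~~ (2 %| gcdz p q)%Z by rewrite pq1.
    by rewrite dvdz_gcd p2.
  exists 1; split => //.
  + by rewrite mulr1 rpredB.
  + by move: q2; lia.
Qed.

Section DoubleRoot.

Variables (p q : int) (s : nat) (c : int).
Hypothesis c_root : double_root_mod p q s c.

(** The second congruence is G_n = n c^(n-1) multiplied by c, which avoids the exponent n - 1 at n =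
    0. *)
Lemma lucasG_double_root (n : nat) :
  (s%:Z %| lucasG p q n.+1 - n.+1%:Z * c ^+ n)%Z
  /\ (s%:Z %| lucasG p q n * c - n%:Z * c ^+ n)%Z.
Proof.
have [sp sq _] := c_root.
elim: n => [|n [IH1 IH2]]; first by rewrite /= mulr1 subrr mul0r mul0r subrr dvdz0.
split.
  have -> : lucasG p q n.+2 - n.+2%:Z * c ^+ n.+1
    = (p - 2 * c) * lucasG p q n.+1 + (q + c ^+ 2) * lucasG p q n
      + 2 * c * (lucasG p q n.+1 - n.+1%:Z * c ^+ n)
      - c * (lucasG p q n * c - n%:Z * c ^+ n).
    rewrite lucasGSS exprS !intS; ring.
  by rewrite rpredB ?rpredD // ?(dvdz_mulr _ sp) ?(dvdz_mulr _ sq) // dvdz_mull.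
have -> : lucasG p q n.+1 * c - n.+1%:Z * c ^+ n.+1
    = c * (lucasG p q n.+1 - n.+1%:Z * c ^+ n) by rewrite exprS; ring.
exact: dvdz_mull.
Qed.

Lemma dvdz_lucasG (n : nat) : (s %| n)%N = (s%:Z %| lucasG p q n)%Z.
Proof.
have [_ _ sc] := c_root.
have [_ h] := lucasG_double_root n.
have scn : coprimez s (c ^+ n) by rewrite coprimezXr.
have -> : (s %| n)%N = (s%:Z %| n%:Z)%Z by [].
rewrite -(Gauss_dvdzl _ scn) -[RHS](Gauss_dvdzl _ sc).
by rewrite -[lucasG p q n * c](subrK (n%:Z * c ^+ n)) (rpredDl _ h).
Qed.

End DoubleRoot.

(* With X = G_n and y = G_(n+1) - p G_n, this is the binomial expansion of
   (X alpha + y)^j modulo X^2; the factor y^2 avoids the exponent j - 2. *)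
Lemma lucasG_mul_expansion (p q : int) (n j : nat) (X := lucasG p q n)
    (y := lucasG p q n.+1 - p * lucasG p q n) :
  exists A B D : int,
  [/\ lucasG p q (j * n) = X * A,
      lucasG p q (j * n).+1 = p * X * A + y ^+ j + X ^+ 2 * B
    & y ^+ 2 * A
      = j%:Z * y ^+ j.+1 + 'C(j, 2)%:Z * p * X * y ^+ j + X ^+ 2 * D].
Proof.
have eX : lucasG p q n = X by [].
have ey : lucasG p q n.+1 = y + p * X by rewrite /y /X; ring.
clearbody y X; elim: j => [|j [A [B [D [hA hB hD]]]]].
  by exists 0, 0, 0; rewrite mul0n bin0n /=; split; ring.
have [a1 a2] := lucasG_add p q (j * n) n.
rewrite mulSn addnC a1 a2 hA hB eX ey.
(* The new A is the addition formula with X factored out. In y^2 A the terms linear in X combine by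
   Pascal's rule C(j+1, 2) = C(j, 2) + j; the next witness collects the rest. *)
exists (y * A + p * X * A + y ^+ j + X ^+ 2 * B), (q * A + y * B).
exists ((p * X + y) * D + p ^+ 2 * 'C(j, 2)%:Z * y ^+ j + y ^+ 2 * B).
split; first by ring.
  by rewrite (exprS y j); ring.
have -> : y ^+ 2 * (y * A + p * X * A + y ^+ j + X ^+ 2 * B)
    = (y + p * X) * (y ^+ 2 * A) + y ^+ 2 * y ^+ j + y ^+ 2 * X ^+ 2 * B by ring.
by rewrite hD binS bin1 PoszD intS !exprS; ring.
Qed.

(** Taking j = s in the expansion gives A = s y^(s-1) modulo s^2, so A = s u with u = y^(s-1) modulo
    s. Here y is prime to s, being c^n modulo s. *)
Lemma lucasG_lift (p q : int) (s : nat) (c : int) (n : nat) :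
  (0 < s)%N -> double_root_mod p q s c -> (s %| n)%N ->
  exists2 u, coprimez s u & lucasG p q (s * n) = s%:Z * u * lucasG p q n.
Proof.
move=> s_gt0 c_root s_n.
have [sp _ sc] := c_root.
have s_X : (s%:Z %| lucasG p q n)%Z by rewrite -(dvdz_lucasG c_root).
have [h _] := lucasG_double_root c_root n.
have [A [B [D [hA _ hD]]]] := lucasG_mul_expansion p q n s.
set y := _ - _ in hD.
have sy : coprimez s y.
  have /dvdzP[t yE] : (s%:Z %| y - c ^+ n)%Z.
    have -> : y - c ^+ n = lucasG p q n.+1 - n.+1%:Z * c ^+ n
        + n%:Z * c ^+ n - lucasG p q n * p by rewrite /y intS; ring.
    by apply: rpredB; [apply: rpredD|]; rewrite ?h ?dvdz_mulr.
  have -> : y = t * s + c ^+ n by rewrite -yE subrK.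
  by rewrite /coprimez gcdzMDl; exact: coprimezXr.
have sy2 : coprimez (s%:Z ^+ 2) (y ^+ 2) by rewrite coprimezXr // coprimezXl.
have [X XE] := dvdzP s_X; have [d dE] := dvdzP sp.
(* From here [s] is the former s minus 1, so that y^(s-1) becomes [y ^+ s]; [X] is now G_n divided
   by the former s. *)
case: s => [//|s] in s_gt0 s_n c_root sp sc s_X h hA hD sy sy2 XE dE *.
have C2 : 2 * 'C(s.+1, 2)%:Z = s.+1%:Z * s%:Z.
  by rewrite -!PoszM -(mul_bin_diag s.+1 1) bin1.
have /dvdzP[t tE] : (s.+1%:Z ^+ 2 %| A - s.+1%:Z * y ^+ s)%Z.
  rewrite -(Gauss_dvdzr _ sy2).
  have -> : y ^+ 2 * (A - s.+1%:Z * y ^+ s) = s.+1%:Z ^+ 2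
      * (X * (c * s%:Z + d * 'C(s.+1, 2)%:Z) * y ^+ s.+1 + X ^+ 2 * D).
    (* The factor 2 of 2c turns the binomial into 2 C(s, 2) = s (s - 1), which supplies the second
       factor s even when s is even. *)
    have pE : p = 2 * c + d * s.+1%:Z by rewrite -dE; ring.
    have -> : y ^+ 2 * (A - s.+1%:Z * y ^+ s)
      = c * X * s.+1%:Z * y ^+ s.+1 * (2 * 'C(s.+1, 2)%:Z)
        + s.+1%:Z ^+ 2 * (X * d * 'C(s.+1, 2)%:Z * y ^+ s.+1 + X ^+ 2 * D).
      by rewrite mulrBr hD XE pE !exprS; ring.
    by rewrite C2; ring.
  exact: dvdz_mulr.
exists (t * s.+1%:Z + y ^+ s).
  by rewrite /coprimez gcdzMDl; exact: coprimezXr.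
by rewrite hA -[A](subrK (s.+1%:Z * y ^+ s)) tE; ring.
Qed.

Lemma lucasG_lift_iter (p q : int) (s : nat) (c : int) (k n : nat) :
  (0 < s)%N -> double_root_mod p q s c -> (s %| n)%N ->
  exists2 u, coprimez s u
    & lucasG p q (s ^ k * n) = (s ^ k)%N%:Z * u * lucasG p q n.
Proof.
move=> s_gt0 c_root s_n; elim: k => [|k [u su uE]].
  by exists 1; [rewrite /coprimez gcdz1 | rewrite expn0 mul1n !mul1r].
have s_kn : (s %| s ^ k * n)%N by exact: dvdn_mull.
have [v sv vE] := lucasG_lift s_gt0 c_root s_kn.
exists (u * v); first by rewrite coprimezMr su.
by rewrite expnS -mulnA vE uE PoszM; ring.
Qed.

Theorem theorem1p2 (p q : int) (s : nat)
    (hr : lucas_disc p q <> 0) (hs : (0 < s)%N) (hpqs : admissible p q s) :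
  (forall n : nat, (s %| n)%N <-> (s%:Z %| lucasG p q n)%Z)
  /\
  ((forall t : nat, (0 < t)%N -> ~~ (s %| t)%N ->
      ~~ ((s ^ 2)%N%:Z %| lucasG p q (s * t)%N)%Z) ->
   forall k n : nat,
     (s ^ k %| n)%N <-> ((s ^ k)%N%:Z %| lucasG p q n)%Z).
Proof.
have [c c_root] := admissible_double_root hpqs.
split=> [n|not_s2 k n]; first by rewrite (dvdz_lucasG c_root).
split.
  (* Only k of the k + 1 factors come from lifting; the last one is s dividing G_(ms), by (1). *)
  case: k => [|k]; first by rewrite expn0 dvd1z.
  case/dvdnP=> m ->.
  have s_ms : (s %| m * s)%N by exact: dvdn_mull.
  have [u _ uE] := lucasG_lift_iter k hs c_root s_ms.
  have -> : (m * s ^ k.+1 = s ^ k * (m * s))%N by rewrite expnSr mulnCA.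
  rewrite uE expnSr PoszM dvdz_mul ?dvdz_mulr //.
  by rewrite -(dvdz_lucasG c_root).
elim: k => [|[|k] IH]; first by rewrite expn0 dvd1n.
  by rewrite expn1 (dvdz_lucasG c_root).
(* By induction n = s^k (s m); cancelling s^k u leaves s^2 dividing G_(sm), and the hypothesis with
   t = m forces s to divide m. *)
move=> s_G.
have /IH/dvdnP[m nE] : ((s ^ k.+1)%N%:Z %| lucasG p q n)%Z.
  by apply: dvdz_trans s_G; rewrite expnS PoszM dvdz_mull.
have s_sm : (s %| s * m)%N by exact: dvdn_mulr.
have [u su uE] := lucasG_lift_iter k hs c_root s_sm.
have nE' : (n = s ^ k * (s * m))%N by rewrite nE expnSr mulnC mulnA.
have s2_G : ((s ^ 2)%N%:Z %| lucasG p q (s * m))%Z.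
  have s2u : coprimez (s ^ 2)%N%:Z u by rewrite -mulnn PoszM coprimezMl su.
  rewrite -(Gauss_dvdzr _ s2u).
  have sk_neq0 : (s ^ k)%N%:Z != 0 by have := expn_gt0 s k; rewrite hs; lia.
  by rewrite -(dvdz_mul2l sk_neq0) mulrA -uE -nE' -PoszM -expnD addn2.
rewrite nE expnS dvdn_pmul2r ?expn_gt0 ?hs //.
(* The hypothesis covers positive t only, so m = 0 is separate. *)
have [->|m_gt0] := posnP m; first exact: dvdn0.
by apply: contraTT s2_G => /(not_s2 _ m_gt0).
Qed.
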